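(* Let $n$ be a positive integer and $1\le k\le \lfloor\frac{n+1}{2}\rfloor-2$. Then $$W_{n,k+2}(x)=\left(a(n,k)x+b(n,k)\right)W_{n,k+1}(x)-c(n,k)W_{n,k}(x),$$ where $W_{n,k}(x)=\sum_{m=0}^{k}w_{n,k,m}x^m$ and $a(n,k)=\frac{(n-k)(n-2k-2)(n-2k-3)}{(k+1)(k+2)(n-k-2)}$, $b(n,k)=\frac{2(n-k)(n-k-1)(n-2k-2)}{(k+2)(n-k-2)(n-2k-1)}$, $c(n,k)=\frac{(n-k+1)(n-k)^{2}(n-2k-3)}{(k+1)(k+2)(n-k-2)(n-2k-1)}$.
   Context: For integers $n,k,m$ (with $k\ge1$) define $w_{n,k,m}=\frac{1}{k}\binom{n}{k-1}\binom{n-k-1}{m-1}\binom{k}{m}$ if $0<m\le k$ and $k+m\le n$; $w_{n,k,m}=1$ if $m=0$ and $n=k$; and $w_{n,k,m}=0$ otherwise. (Combinatorially, $w_{n,k,m}$ is the number of Dyck paths of semilength $n$ with $k$ occurrences of $UD$ and $m$ occurrences of $UUD$.) *)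

(* Defs.v *)
From mathcomp Require Import all_boot all_order all_algebra.

Set Implicit Arguments.
Unset Strict Implicit.
Unset Printing Implicit Defensive.

Import GRing.Theory Num.Theory.
Local Open Scope ring_scope.

(* The nat subtractions in the first branch are never truncated there, since
   0 < m and k + m <= n. *)
Definition w (n k m : nat) : rat :=
  if [&& (0 < m)%N, (m <= k)%N & (k + m <= n)%N] then
    k%:R^-1 * 'C(n, k - 1)%:R * 'C(n - k - 1, m - 1)%:R * 'C(k, m)%:R
  else if (m == 0%N) && (n == k) then 1
  else 0.

Definition W (n k : nat) : {poly rat} := \sum_(0 <= m < k.+1) (w n k m)%:P * 'X^m.

(* The subtractions below are taken in rat. *)
Definition a (n k : nat) : rat :=
  let n' : rat := n%:R in let k' : rat := k%:R in
  ((n' - k') * (n' - 2 * k' - 2) * (n' - 2 * k' - 3))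
  / ((k' + 1) * (k' + 2) * (n' - k' - 2)).

Definition b (n k : nat) : rat :=
  let n' : rat := n%:R in let k' : rat := k%:R in
  (2 * (n' - k') * (n' - k' - 1) * (n' - 2 * k' - 2))
  / ((k' + 2) * (n' - k' - 2) * (n' - 2 * k' - 1)).

Definition c (n k : nat) : rat :=
  let n' : rat := n%:R in let k' : rat := k%:R in
  ((n' - k' + 1) * (n' - k') ^+ 2 * (n' - 2 * k' - 3))
  / ((k' + 1) * (k' + 2) * (n' - k' - 2) * (n' - 2 * k' - 1)).

(* Main.v *)
Require Import Defs.
From mathcomp Require Import all_boot all_order all_algebra.
From mathcomp Require Import zify ring lra.

Import GRing.Theory Num.Theory.
Local Open Scope ring_scope.

(** Compare coefficients of [x^(j+1)].  The constant coefficients all vanish.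
    For [j >= 1] every binomial coefficient that occurs is a rational multiple of
    one of [C(n, k-1)], [C(n-k-1, j)] and [C(k+2, j+1)].  Working downwards from
    these largest binomials, the denominators involve [n] and [k] only and never
    vanish, even where the smaller binomials do, so the recurrence becomes a
    single identity between rational functions of [n], [k], [j]. *)

(** Valid for every [m]: beyond [k] both sides are zero. *)
Lemma coef_W (n k m : nat) : (W n k)`_m = w n k m.
Proof.
rewrite /W big_mkord coef_sum.
under eq_bigr => i _ do rewrite coefCM coefXn.
have [lt_mk|le_km] := ltnP m k.+1.
  rewrite (bigD1 (Ordinal lt_mk)) //= eqxx mulr1 big1 ?addr0 // => i ne_i.
  suff -> : (m == i) = false by rewrite mulr0.
  by rewrite eq_sym; apply: negbTE.
rewrite big1 => [|i _]; last first.
  suff -> : (m == i) = false by rewrite mulr0.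
  by have := ltn_ord i; lia.
by rewrite /w [(m <= k)%N]leqNgt le_km andbF; case: m le_km.
Qed.

Lemma w_0 (n k : nat) : (k < n)%N -> w n k 0 = 0.
Proof. by move=> lt_kn; rewrite /w /= gtn_eqF. Qed.

(* The range conditions of [w] are absorbed by the vanishing of binomials. *)
Lemma w_S (n k j : nat) : (k < n)%N ->
  w n k j.+1 = k%:R^-1 * 'C(n, k - 1)%:R * 'C(n - k - 1, j)%:R * 'C(k, j.+1)%:R.
Proof.
move=> lt_kn; rewrite /w /= subSS subn0.
case: (leqP j.+1 k) => [le_jk|lt_kj] /=; last by rewrite (bin_small lt_kj) mulr0.
case: leqP => [//|lt_n].
by rewrite [X in _ * X%:R * _]bin_small ?mulr0 ?mul0r //; lia.
Qed.

Section RationalBinomials.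
Variable F : numFieldType.

(** With the subtraction taken in [F] this covers [j >= n] too: the factor vanishes at [j = n], and
    past it both binomials do. *)
Lemma natr_bin_succr (n j : nat) :
  'C(n, j.+1)%:R = (n%:R - j%:R) / j.+1%:R * 'C(n, j)%:R :> F.
Proof.
have [le_jn|lt_nj] := leqP j n; last by rewrite !bin_small ?mulr0 //; lia.
apply: (@mulfI _ j.+1%:R); first by rewrite pnatr_eq0.
rewrite -natrM mul_bin_left natrM natrB //.
by rewrite mulrA mulrCA divff ?mulr1 // pnatr_eq0.
Qed.

Lemma natr_bin_predl (n j : nat) :
  'C(n, j)%:R = (n.+1%:R - j%:R) / n.+1%:R * 'C(n.+1, j)%:R :> F.
Proof.
have [le_jn|lt_nj] := leqP j n.+1; last by rewrite !bin_small ?mulr0 //; lia.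
have nz : n.+1%:R != 0 :> F by rewrite pnatr_eq0.
apply: (mulfI nz); rewrite -natrM mul_bin_down natrM natrB //.
by rewrite mulrA mulrCA divff // mulr1.
Qed.

Lemma natr_bin_pred_diag (n j : nat) :
  'C(n, j)%:R = j.+1%:R / n.+1%:R * 'C(n.+1, j.+1)%:R :> F.
Proof.
have nz : n.+1%:R != 0 :> F by rewrite pnatr_eq0.
apply: (mulfI nz); rewrite -natrM mul_bin_diag natrM.
by rewrite mulrA mulrCA divff // mulr1.
Qed.

End RationalBinomials.

Lemma w_S_rec (n k j : nat) : (1 <= k)%N -> (2 * k + 3 <= n)%N ->
  w n (k + 2) j.+1 =
    a n k * w n (k + 1) j + b n k * w n (k + 1) j.+1 - c n k * w n k j.+1.
Proof.
case: k => // k _ le_kn.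
(* The upper indices of the second binomial in [w_S] become [N], [N.+1], [N.+2], free of truncated
   subtraction. *)
have [N def_n] : exists N, n = (N + k + 4)%N by exists (n - k - 4)%N; lia.
subst n.
have le_kN : (k < N)%N by lia.
have K0 : 0 <= k%:R :> rat by [].
(* Keeps the denominator [n - 2k - 1], now [N - k + 1], positive. *)
have KN : k%:R + 1 <= N%:R :> rat by rewrite natr1 ler_nat.
have binS2 : 'C(N + k + 4, k + 2)%:R = (N%:R + 4) * (N%:R + 3)
    / ((k%:R + 2) * (k%:R + 1)) * 'C(N + k + 4, k)%:R :> rat.
  rewrite addn2 !natr_bin_succr !(natrD, =^~ natr1).
  by field; apply/andP; split; lra.
have binS1 : 'C(N + k + 4, k.+1)%:R = (N%:R + 4)
    / (k%:R + 1) * 'C(N + k + 4, k)%:R :> rat.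
  rewrite natr_bin_succr !(natrD, =^~ natr1).
  by field; lra.
have e1 : (k.+1 + 2 - 1 = k + 2)%N by lia.
have e2 : (k.+1 + 1 - 1 = k.+1)%N by lia.
have e3 : (k.+1 - 1 = k)%N by lia.
have e4 : (N + k + 4 - (k.+1 + 2) - 1 = N)%N by lia.
have e5 : (N + k + 4 - (k.+1 + 1) - 1 = N.+1)%N by lia.
have e6 : (N + k + 4 - k.+1 - 1 = N.+2)%N by lia.
(* For [j = 0] the [a] term drops out, by [w_0]. *)
case: j => [|j]; rewrite ?[w _ _ 0]w_0 ?w_S; try lia;
  rewrite e1 e2 e3 e4 e5 e6 binS2 binS1 /a /b /c.
  rewrite !bin0 !bin1 !(natrD, =^~ natr1).
  field.
  by repeat (apply/andP; split); lra.
have J0 : 0 <= j%:R :> rat by [].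
(* Everything is raised to the common factors ['C(N.+2, j.+1)] and ['C(k.+3, j.+2)]. *)
rewrite !addn1 !addn2 (natr_bin_predl _ N j.+1) (natr_bin_pred_diag _ N.+1 j).
rewrite (natr_bin_predl _ N.+1 j.+1).
rewrite (natr_bin_predl _ k.+1 j.+2) (natr_bin_pred_diag _ k.+2 j.+1).
rewrite (natr_bin_predl _ k.+2 j.+2) !(natrD, =^~ natr1).
field.
by repeat (apply/andP; split); lra.
Qed.

Theorem theorem2p6 (n k : nat) (hn : (0 < n)%N) (hk1 : (1 <= k)%N)
    (hk2 : (k <= (n + 1) %/ 2 - 2)%N) :
  W n (k + 2) =
    ((a n k)%:P * 'X + (b n k)%:P) * W n (k + 1) - (c n k)%:P * W n k.
Proof.
(* Since [k >= 1], the natural subtraction in [hk2] is not truncated. *)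
have le_kn : (2 * k + 3 <= n)%N by lia.
apply/polyP=> [[|j]].
  rewrite coefB mulrDl coefD -mulrA !coefCM coefXM !coef_W /=.
  by rewrite !w_0 ?mulr0 ?addr0 ?subr0 //; lia.
by rewrite coefB mulrDl coefD -mulrA !coefCM coefXM !coef_W /= w_S_rec.
Qed.
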